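(* Let $L$ be a finite-dimensional restricted Lie algebra over an algebraically closed field $F$ of characteristic $p>0$, and let $U$ be a proper subalgebra of $L$. Then the following are equivalent: (i) $U$ is modular in $L$; (ii) $U$ is semi-modular in $L$; (iii) $U$ is a quasi-ideal of $L$.
   Context: For subalgebras $U,B$ of a Lie algebra $L$, $\langle U,B\rangle$ denotes the subalgebra generated by $U\cup B$. A subalgebra $B$ covers a subalgebra $A$ if $A$ is a maximal subalgebra of $B$. $U$ is modular in $L$ if $\langle U,B\rangle\cap C=\langle B,U\cap C\rangle$ for all subalgebras $B\subseteq C$ of $L$, and $\langle U,B\rangle\cap C=\langle B\cap C,U\rangle$ for all subalgebras $B,C$ of $L$ with $U\subseteq C$. $U$ is upper modular (um) in $L$ if whenever $B$ is a subalgebra of $L$ which covers $U\cap B$, then $\langle U,B\rangle$ covers $U$; $U$ is lower modular (lm) in $L$ if whenever $B$ is a subalgebra of $L$ such that $\langle U,B\rangle$ covers $U$, then $B$ covers $U\cap B$; $U$ is semi-modular (sm) in $L$ if it is both um and lm. A subalgebra $Q$ is a quasi-ideal of $L$ if $[Q,V]\subseteq Q+V$ for every subspace $V$ of $L$. *)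

(* Defs.v *)
From HB Require Import structures.
From mathcomp Require Import all_boot all_order all_algebra.
Set Implicit Arguments. Unset Strict Implicit. Unset Printing Implicit Defensive.
Import GRing.Theory.
Local Open Scope ring_scope.

Section LieDefs.
Variables (F : fieldType) (L : vectType F) (br : L -> L -> L).

Definition is_lie : Prop :=
  [/\ (forall a x y z, br (a *: x + y) z = a *: br x z + br y z),
      (forall a x y z, br z (a *: x + y) = a *: br z x + br z y),
      (forall x, br x x = 0) &
      (forall x y z, br x (br y z) + br y (br z x) + br z (br x y) = 0)].

Definition adword (n : nat) (w : {ffun 'I_n -> bool}) (x y : L) : L :=
  foldr (fun j acc => br (if w j then x else y) acc) x (enum 'I_n).

(* Jacobson's s_i(x,y): i * s_i(x,y) is the coefficient of t^(i-1)
   in ad(t x + y)^(p-1) (x). *)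
Definition jac_s (p i : nat) (x y : L) : L :=
  (i%:R)^-1 *: \sum_(w : {ffun 'I_p.-1 -> bool} | #|[set j | w j]| == i.-1)
                 adword w x y.

Definition is_restricted (p : nat) (pm : L -> L) : Prop :=
  [/\ (forall (a : F) x, pm (a *: x) = a ^+ p *: pm x),
      (forall x y, br (pm x) y = iter p (br x) y) &
      (forall x y, pm (x + y) = pm x + pm y + \sum_(1 <= i < p) jac_s p i x y)].

Definition subalg (V : {vspace L}) : Prop :=
  forall x y, x \in V -> y \in V -> br x y \in V.

Definition gen_step (V : {vspace L}) : {vspace L} :=
  (V + <<[seq br x y | x <- vbasis V, y <- vbasis V]>>)%VS.

(* <U, B>: the subalgebra generated by U \cup B (the chain stabilizes
   after at most dim L steps) *)
Definition gen (U B : {vspace L}) : {vspace L} :=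
  iter (\dim {: L}) gen_step (U + B)%VS.

Definition covers (B A : {vspace L}) : Prop :=
  [/\ subalg A, subalg B, (A <= B)%VS, A != B &
      forall C : {vspace L}, subalg C -> (A <= C)%VS -> (C <= B)%VS ->
        C = A \/ C = B].

Definition modular (U : {vspace L}) : Prop :=
  (forall B C : {vspace L}, subalg B -> subalg C -> (B <= C)%VS ->
      (gen U B :&: C)%VS = gen B (U :&: C)%VS) /\
  (forall B C : {vspace L}, subalg B -> subalg C -> (U <= C)%VS ->
      (gen U B :&: C)%VS = gen (B :&: C)%VS U).

Definition upper_modular (U : {vspace L}) : Prop :=
  forall B : {vspace L}, subalg B -> covers B (U :&: B)%VS -> covers (gen U B) U.

Definition lower_modular (U : {vspace L}) : Prop :=
  forall B : {vspace L}, subalg B -> covers (gen U B) U -> covers B (U :&: B)%VS.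

Definition semi_modular (U : {vspace L}) : Prop :=
  upper_modular U /\ lower_modular U.

Definition quasi_ideal (Q : {vspace L}) : Prop :=
  forall V : {vspace L}, forall q v, q \in Q -> v \in V -> br q v \in (Q + V)%VS.

End LieDefs.

(* Main.v *)
(* A quasi-ideal [U] permutes with every subalgebra, so <U,B> = U + B and
   modularity is the modular law of subspaces; modularity gives
   semi-modularity as in any lattice.

   Let [U] be semi-modular and let [Q] be the set of all [x] such that
   [U + <x>] is a subalgebra.  Upper modularity makes [Q] a subspace.  If
   [ad s] is diagonalizable, lower modularity applied to the 2-dimensional
   algebras [<s, y>], with [y] an eigenvector of [s] in [<U, s>], gives
   [s \in Q].  For [p^e >= dim L] every [x^[p]^e] has diagonalizable adjoint
   action, so [(u + c y)^[p]^e] lies in [Q] for all scalars [c]; this is a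
   polynomial in [c], whose linear coefficient is [(ad u)^(p^e - 1) y].  Hence
   each [u] in [U] acts nilpotently on [L / Q].  If [Q] were not [L], Engel's
   theorem would give [x] outside [Q] with [[U, x] <= Q]; but [<U, x>] meets [Q]
   in [U] only, so [x] normalizes [U] and thus belongs to [Q]. *)

Require Import Defs.
From HB Require Import structures.
From mathcomp Require Import all_boot all_order all_algebra.
From Stdlib Require Import Classical.
Import GRing.Theory.
Local Open Scope ring_scope.

Set Implicit Arguments.
Unset Strict Implicit.
Unset Printing Implicit Defensive.

(** * Subspaces and generated subalgebras *)

Section VectorSpaces.
Variables (F : fieldType) (L : vectType F).
Implicit Types (U V W : {vspace L}) (x y z : L).

Lemma mem_add_line U x z :
  (z \in U + <[x]>)%VS <-> exists a, z - a *: x \in U.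
Proof.
split=> [/memv_addP[u Uu [_ /vlineP[a ->] ->]]|[a Ua]].
  by exists a; rewrite addrK.
rewrite -[z](subrK (a *: x)); apply: memv_add => //.
by apply: memvZ; apply: memv_line.
Qed.

Lemma mem_add_line_self U x : x \in (U + <[x]>)%VS.
Proof. exact: subvP (addvSr _ _) _ (memv_line x). Qed.

Lemma add_line_sub U W x : (U <= W)%VS -> x \in W -> (U + <[x]> <= W)%VS.
Proof. by move=> UW xW; rewrite subv_add UW -memvE. Qed.

Lemma add_line_exchange U x z :
  z \in (U + <[x]>)%VS -> z \notin U -> x \in (U + <[z]>)%VS.
Proof.
move=> /mem_add_line[a Ua] zU; have a0 : a != 0.
  by apply: contraNneq zU => a0; rewrite a0 scale0r subr0 in Ua.
apply/mem_add_line; exists a^-1.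
have -> : x - a^-1 *: z = - (a^-1 *: (z - a *: x)).
  by rewrite scalerBr scalerA mulVf // scale1r opprB.
by rewrite memvN memvZ.
Qed.

Lemma add_line_neq U x : x \notin U -> U != (U + <[x]>)%VS.
Proof.
by move=> xU; apply: contraNneq xU => ->; rewrite mem_add_line_self.
Qed.

Lemma dim_add_line U x : x \notin U -> (\dim U < \dim (U + <[x]>))%N.
Proof.
move=> xU; rewrite ltn_neqAle dimvS ?addvSl // andbT.
by apply: contra (add_line_neq xU) => /eqP dU; rewrite eqEdim addvSl dU leqnn.
Qed.

(** A subspace inside [P] that misses a vector of [P] can be enlarged by that vector, which happens
    only finitely often. Since [P] need not be decidable, the case split is classical. *)
Lemma vspace_of_pred (P : L -> Prop) :
  P 0 -> (forall a x y, P x -> P y -> P (a *: x + y)) ->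
  exists W : {vspace L}, forall x, x \in W <-> P x.
Proof.
move=> P0 Plin.
suff IH n W : (\dim {:L} - \dim W < n)%N -> (forall x, x \in W -> P x) ->
    exists W : {vspace L}, forall x, x \in W <-> P x.
  by apply: (IH _ 0%VS) => [|x]; rewrite ?memv0 //; move/eqP->.
elim: n => // n IHn in W *; move=> dW PW.
case: (classic (exists x, P x /\ x \notin W)) => [[x [Px xW]]|nW].
  apply: (IHn (W + <[x]>)%VS) => [|z /mem_add_line[a Wz]].
    have := dim_add_line xW; have := dimvS (subvf (W + <[x]>)%VS).
    move=> le1 lt1; apply: leq_trans (_ : \dim {:L} - \dim W <= _)%N => //.
    by apply: ltn_sub2l => //; apply: leq_trans le1.
  by rewrite -[z](subrK (a *: x)) addrC; apply: Plin => //; apply: PW.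
exists W => x; split=> [/PW //|Px].
by apply: contraT => xW; case: nW; exists x.
Qed.

End VectorSpaces.

(** * Bracket identities and generated subalgebras *)

Section LieAlgebra.
Variables (F : fieldType) (L : vectType F) (br : L -> L -> L).
Hypothesis hLie : is_lie br.
Implicit Types (U V W B C : {vspace L}) (x y z : L).

Lemma brDl x y z : br (x + y) z = br x z + br y z.
Proof. by have [H _ _ _] := hLie; have := H 1 x y z; rewrite !scale1r. Qed.
Lemma brDr x y z : br z (x + y) = br z x + br z y.
Proof. by have [_ H _ _] := hLie; have := H 1 x y z; rewrite !scale1r. Qed.
Lemma br0l z : br 0 z = 0.
Proof. by apply: (@addIr _ (br 0 z)); rewrite -brDl !add0r. Qed.
Lemma br0r z : br z 0 = 0.
Proof. by apply: (@addIr _ (br z 0)); rewrite -brDr !add0r. Qed.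
Lemma brZl a x z : br (a *: x) z = a *: br x z.
Proof. by have [H _ _ _] := hLie; have := H a x 0 z; rewrite br0l !addr0. Qed.
Lemma brZr a x z : br z (a *: x) = a *: br z x.
Proof. by have [_ H _ _] := hLie; have := H a x 0 z; rewrite br0r !addr0. Qed.
Lemma brNr x z : br z (- x) = - br z x.
Proof. by rewrite -scaleN1r brZr scaleN1r. Qed.
Lemma brxx x : br x x = 0. Proof. by have [_ _ ->] := hLie. Qed.
Lemma br_anti x y : br x y = - br y x.
Proof.
apply/eqP; rewrite -addr_eq0; have := brxx (x + y).
by rewrite brDl !brDr !brxx add0r addr0 => ->.
Qed.
Lemma br_jacobi x y z : br x (br y z) = br (br x y) z + br y (br x z).
Proof.
have [_ _ _ /(_ x y z) /eqP] := hLie; rewrite -addrA addr_eq0 => /eqP ->.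
by rewrite opprD addrC (br_anti z (br x y)) (br_anti z x) brNr !opprK.
Qed.
Lemma br_suml I (r : seq I) (P : pred I) (E : I -> L) z :
  br (\sum_(i <- r | P i) E i) z = \sum_(i <- r | P i) br (E i) z.
Proof.
by apply: (big_morph (br^~ z) (fun x y => brDl x y z) (br0l z)).
Qed.
Lemma br_sumr I (r : seq I) (P : pred I) (E : I -> L) z :
  br z (\sum_(i <- r | P i) E i) = \sum_(i <- r | P i) br z (E i).
Proof.
by apply: (big_morph (br z) (fun x y => brDr x y z) (br0r z)).
Qed.

Lemma iter_brDr n z x y :
  iter n (br z) (x + y) = iter n (br z) x + iter n (br z) y.
Proof. by elim: n => //= n ->; rewrite brDr. Qed.
Lemma iter_brZr n z a x : iter n (br z) (a *: x) = a *: iter n (br z) x.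
Proof. by elim: n => //= n ->; rewrite brZr. Qed.

Lemma subalg_cap B C : subalg br B -> subalg br C -> subalg br (B :&: C)%VS.
Proof.
move=> hB hC x y; rewrite !memv_cap => /andP[xB xC] /andP[yB yC].
by rewrite hB ?hC.
Qed.

Lemma subalg_line x : subalg br <[x]>%VS.
Proof.
move=> y z /vlineP[a ->] /vlineP[b ->].
by rewrite brZl brZr brxx !scaler0 mem0v.
Qed.

Lemma subalg_add_line U x : subalg br U ->
  (forall u, u \in U -> br u x \in (U + <[x]>)%VS) ->
  subalg br (U + <[x]>)%VS.
Proof.
move=> hU hx z w /memv_addP[u uU [_ /vlineP[a ->] ->]].
move=> /memv_addP[v vU [_ /vlineP[b ->] ->]].
rewrite brDl !brDr !brZl !brZr brxx !scaler0 addr0 (br_anti x v).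
by rewrite !memvD ?memvZ ?memvN ?hx // (subvP (addvSl _ _)) ?hU.
Qed.

(** By bilinearity, closure under the bracket only has to be tested on a basis. *)
Lemma subalg_gen_stepP V : subalg br V <-> (gen_step br V <= V)%VS.
Proof.
rewrite /gen_step subv_add subvv /=; split=> [hV|].
  apply/span_subvP => _ /allpairsP[[x y] /= [xV yV ->]].
  by apply: hV; apply: vbasis_mem.
move=> /span_subvP hV x y xV yV.
rewrite (coord_vbasis xV) (coord_vbasis yV) br_suml.
apply: rpred_sum => i _; rewrite br_sumr; apply: rpred_sum => j _.
rewrite brZl brZr !memvZ //; apply: hV; apply/allpairsP.
by exists ((vbasis V)`_i, (vbasis V)`_j); rewrite !mem_nth ?size_tuple.
Qed.

Lemma gen_ge U B : (U + B <= gen br U B)%VS.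
Proof.
rewrite /gen; elim: (\dim _) => //= n IHn.
by apply: subv_trans IHn _; apply: addvSl.
Qed.

Lemma gen_gel U B : (U <= gen br U B)%VS.
Proof. exact: subv_trans (addvSl _ _) (gen_ge U B). Qed.

Lemma gen_ger U B : (B <= gen br U B)%VS.
Proof. exact: subv_trans (addvSr _ _) (gen_ge U B). Qed.

(** Each [gen_step] either leaves the space fixed, and then it is a subalgebra, or raises its
    dimension; after [\dim {:L}] steps the chain is stable or fills [L]. *)
Lemma subalg_gen U B : subalg br (gen br U B).
Proof.
rewrite /gen; set V := (U + B)%VS.
have stab n : subalg br (iter n (gen_step br) V) \/
    (n <= \dim (iter n (gen_step br) V))%N.
  elim: n => [|n [hn|le_n]]; first by right.
    left; suff -> : iter n.+1 (gen_step br) V = iter n (gen_step br) V by [].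
    apply/eqP; rewrite eqEsubv /= addvSl andbT.
    exact/subalg_gen_stepP.
  rewrite /=; set W := iter n _ V in le_n *.
  case: (boolP (gen_step br W <= W)%VS) => [sW|nsW].
    left; have -> : gen_step br W = W; last exact/subalg_gen_stepP.
    by apply/eqP; rewrite eqEsubv sW addvSl.
  right; apply: leq_ltn_trans le_n _; rewrite ltnNge.
  apply: contra nsW => le_dim.
  by rewrite -(geq_leqif (dimv_leqif_sup (addvSl W _))).
case: (stab (\dim {:L})) => // le_dim x y _ _.
suff -> : iter (\dim {:L}) (gen_step br) V = fullv by rewrite memvf.
by apply/eqP; rewrite eqEdim subvf le_dim.
Qed.

Lemma gen_sub U B C :
  subalg br C -> (U <= C)%VS -> (B <= C)%VS -> (gen br U B <= C)%VS.
Proof.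
move=> hC UC BC; rewrite /gen; elim: (\dim _) => [|n] /=.
  by rewrite subv_add UC.
move: (iter n _ _) => V VC; rewrite /gen_step subv_add VC /=.
apply/span_subvP => _ /allpairsP[[x y] /= [xV yV ->]].
by apply: hC; apply: (subvP VC); apply: vbasis_mem.
Qed.

Lemma gen_eq U B C : subalg br C -> (U + B <= C)%VS ->
  (C <= gen br U B)%VS -> gen br U B = C.
Proof.
move=> hC; rewrite subv_add => /andP[UC BC] leC.
by apply/eqP; rewrite eqEsubv leC gen_sub.
Qed.

(** * Quasi-ideal implies modular, modular implies semi-modular *)

Lemma quasi_ideal_modular U : subalg br U -> quasi_ideal br U -> modular br U.
Proof.
move=> hU qU.
have addS B : subalg br B -> subalg br (U + B)%VS.
  move=> hB y z /memv_addP[u uU [b bB ->]] /memv_addP[v vU [c cB ->]].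
  rewrite brDl !brDr (br_anti b v).
  apply: memvD; apply: memvD; rewrite ?memvN; try exact: qU.
    by apply: (subvP (addvSl U B)); apply: hU.
  by apply: (subvP (addvSr U B)); apply: hB.
have genE B : subalg br B -> gen br U B = (U + B)%VS.
  by move=> hB; apply: gen_eq; rewrite ?gen_ge //; apply: addS.
split=> B C hB hC sC; rewrite genE //.
  rewrite addvC -vspace_modl //; apply/esym/gen_eq => //;
    last by apply: gen_ge.
  by rewrite vspace_modl // addvC; apply: subalg_cap => //; apply: addS.
rewrite -vspace_modl //; apply/esym/gen_eq => //.
- by rewrite vspace_modl //; apply: subalg_cap => //; apply: addS.
- by rewrite addvC.
- by rewrite addvC gen_ge.
Qed.

(** By the second identity, a subalgebra [C] between [U] and [<U,B>] is recovered from [B :&: C]; by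
    the first, a subalgebra [D] between [U :&: B] and [B] equals [<U,D> :&: B]. So maximality on one
    side passes to the other. *)
Lemma modular_semi_modular U :
  subalg br U -> modular br U -> semi_modular br U.
Proof.
move=> hU [m1 m2]; split=> B hB [h1 h2 h3 h4 h5].
  split=> //; [exact: subalg_gen|exact: gen_gel| |].
    apply: contraNneq h4 => UE; apply/eqP/capv_idPr.
    by rewrite UE gen_ger.
  move=> C hC UC CG.
  have CE : C = gen br (B :&: C)%VS U by rewrite -m2 //; apply/esym/capv_idPr.
  have [] := h5 (B :&: C)%VS (subalg_cap hB hC) _ (capvSl _ _).
  - by rewrite subv_cap capvSr (subv_trans (capvSl _ _)).
  - move=> BCE; left; rewrite CE BCE; apply: gen_eq => //; last exact: gen_ger.
    by rewrite subv_add capvSl subvv.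
  - move=> BCE; right; rewrite CE BCE; apply: gen_eq; first exact: subalg_gen.
      by rewrite addvC gen_ge.
    by apply: gen_sub; [apply: subalg_gen|apply: gen_ger|apply: gen_gel].
split=> //; [exact: subalg_cap|exact: capvSr| |].
  apply: contraNneq h4 => BE; apply/eqP/esym/gen_eq => //.
  by rewrite subv_add subvv -BE capvSl.
move=> D hD sD DB.
have := m1 D B hD hB DB.
have -> : gen br D (U :&: B) = D.
  by apply: gen_eq; rewrite ?subv_add ?subvv ?gen_gel.
have [] := h5 (gen br U D) _ (gen_gel _ _) _.
- exact: subalg_gen.
- apply: gen_sub; [exact: subalg_gen|exact: gen_gel|].
  exact: subv_trans DB (gen_ger _ _).
- by move=> ->; left.
- by move=> -> <-; right; apply/capv_idPr; apply: gen_ger.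
Qed.

End LieAlgebra.

(** * Diagonalizability of p-power iterates *)

Section PolynomialAction.
Variables (F : fieldType) (L : vectType F) (D : L -> L).
Hypothesis DD : forall x y, D (x + y) = D x + D y.
Hypothesis DZ : forall a x, D (a *: x) = a *: D x.
Implicit Types (q r : {poly F}) (x y z : L).

Definition polyact q y := \sum_(i < size q) q`_i *: iter i D y.

Lemma D_sum n (E : 'I_n -> L) : D (\sum_i E i) = \sum_i D (E i).
Proof.
apply: (big_morph D DD); apply: (@addIr _ (D 0)).
by rewrite -DD !add0r.
Qed.

Lemma polyact_wide n q y : (size q <= n)%N ->
  polyact q y = \sum_(i < n) q`_i *: iter i D y.
Proof.
move=> le_n; rewrite /polyact (big_ord_widen n (fun i => q`_i *: iter i D y)) //.
rewrite big_mkcond /=; apply: eq_bigr => i _.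
by case: ltnP => // le_i; rewrite nth_default // scale0r.
Qed.

Lemma polyactD q r y : polyact (q + r) y = polyact q y + polyact r y.
Proof.
pose n := maxn (size q) (size r).
rewrite !(@polyact_wide n) ?size_polyD ?leq_maxl ?leq_maxr // -big_split /=.
by apply: eq_bigr => i _; rewrite coefD scalerDl.
Qed.

Lemma polyactZ a q y : polyact (a *: q) y = a *: polyact q y.
Proof.
rewrite !(@polyact_wide (size q)) ?size_scale_leq // scaler_sumr.
by apply: eq_bigr => i _; rewrite coefZ scalerA.
Qed.

Lemma polyact0 y : polyact 0 y = 0.
Proof. by rewrite /polyact size_poly0 big_ord0. Qed.

Lemma polyactC a y : polyact a%:P y = a *: y.
Proof.
by rewrite (@polyact_wide 1) ?size_polyC_leq1 // big_ord1 coefC.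
Qed.

Lemma polyactXM q y : polyact ('X * q) y = D (polyact q y).
Proof.
rewrite (@polyact_wide (size q).+1); last first.
  by rewrite (leq_trans (size_polyMleq _ _)) // size_polyX.
rewrite big_ord_recl coefXM scale0r add0r (@polyact_wide (size q)) // D_sum.
by apply: eq_bigr => i _; rewrite coefXM /= DZ.
Qed.

Lemma polyactM q r y : polyact (q * r) y = polyact q (polyact r y).
Proof.
elim/poly_ind: q => [|q c IHq] in r y *; first by rewrite mul0r !polyact0.
rewrite mulrDl !polyactD mul_polyC polyactZ polyactC; congr (_ + _).
by rewrite [q * 'X]mulrC -mulrA !polyactXM IHq.
Qed.

Lemma polyactXn n y : polyact 'X^n y = iter n D y.
Proof.
elim: n => [|n IHn]; first by rewrite polyactC scale1r.
by rewrite exprS polyactXM IHn.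
Qed.

(** The [\dim {:L} + 1] vectors [y], [D y], ... are dependent, and a dependence relation is such a
    polynomial. The size bound later bounds the multiplicities of its roots. *)
Lemma polyact_annihilator y :
  exists q, [/\ q != 0, (size q <= (\dim {:L}).+1)%N & polyact q y = 0].
Proof.
set n := \dim {:L}.
pose X := [tuple iter i D y | i < n.+1].
have nX : ~~ free X.
  apply/negP => /eqP sX; have := dimvS (subvf <<X>>).
  by rewrite sX size_tuple ltnn.
have [k [sk [i ki]]] : exists k : 'I_n.+1 -> F,
    \sum_i k i *: X`_i = 0 /\ exists i, k i != 0.
  apply: NNPP => nk; case/negP: nX; apply/freeP => k sk i.
  by apply/eqP; apply: contraT => ki; case: nk; exists k; split=> //; exists i.
exists (\poly_(i < n.+1) k (inord i)); split.
- apply: contraNneq ki => /(congr1 (fun q : {poly F} => q`_i)).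
  by rewrite coef_poly ltn_ord inord_val coef0 => ->.
- exact: size_poly.
rewrite (@polyact_wide n.+1) ?size_poly // -[RHS]sk.
apply: eq_bigr => j _; rewrite coef_poly ltn_ord inord_val.
by rewrite -tnth_nth tnth_mktuple.
Qed.

End PolynomialAction.

(** With [N = p ^ e], the fold applies the factors [D^N - z] to [y] one after another. As
    [X^N - z^N = (X - z)^N] and [N] is at least every multiplicity, the product over the distinct
    roots of an annihilator of [y] is a multiple of that annihilator. *)
Lemma iter_pchar_semisimple (F : closedFieldType) (L : vectType F) (D : L -> L)
    (p e : nat) (y : L) :
  (forall x y, D (x + y) = D x + D y) ->
  (forall a x, D (a *: x) = a *: D x) ->
  p \in [pchar F] -> (\dim {:L} <= p ^ e)%N ->
  exists2 rs : seq F, uniq rs &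
    foldl (fun w z => iter (p ^ e) D w - z *: w) y rs = 0.
Proof.
move=> DD DZ chF le_e; set N := (p ^ e)%N.
have [q [q0 sq qy]] := polyact_annihilator D y.
have [rs qE] := closed_field_poly_normal q.
have sz_rs : (size rs <= N)%N.
  apply: leq_trans le_e; move: sq; rewrite qE size_scale ?lead_coef_eq0 //.
  by rewrite size_prod_XsubC ltnS.
have chN : [pchar {poly F}].-nat N.
  rewrite /N; elim: (e) => // k IHk; rewrite expnS pnatM IHk andbT.
  by apply/pnatP; rewrite ?prime_gt0 ?(pcharf_prime chF)//;
     move=> r r_pr; rewrite dvdn_prime2 ?(pcharf_prime chF)// => /eqP ->;
     rewrite pchar_poly.
have chNF : [pchar F].-nat N by rewrite -(eq_pnat _ (pchar_poly F)).
have XN (z : F) : ('X - z%:P) ^+ N = 'X^N - (z ^+ N)%:P.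
  have := @exprDn_pchar {poly F} ('X - z%:P) z%:P N chN.
  by rewrite subrK rmorphXn => ->; rewrite addrK.
(* The powers stay distinct because [z ^+ N = z' ^+ N] gives [(z - z') ^+ N = 0]. *)
exists [seq z ^+ N | z <- undup rs].
  rewrite map_inj_uniq ?undup_uniq // => z z' /= zz'.
  have := exprDn_pchar (z - z') z' chNF.
  rewrite subrK zz' => /esym /eqP; rewrite -subr_eq0 addrK.
  by rewrite expf_eq0 subr_eq0 => /andP[_ /eqP].
have foldE ts w : foldl (fun w z => iter N D w - z *: w) w ts =
    polyact D (\prod_(z <- ts) ('X^N - z%:P)) w.
  elim: ts w => [|t ts IH] w /=; first by rewrite big_nil polyactC scale1r.
  rewrite IH big_cons mulrC polyactM //; congr polyact.
  by rewrite polyactD polyactXn // -polyCN polyactC scaleNr.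
rewrite foldE big_map.
have -> : \prod_(z <- undup rs) ('X^N - (z ^+ N)%:P) =
    (\prod_(z <- undup rs) ('X - z%:P) ^+ (N - count_mem z rs)) *
      \prod_(z <- rs) ('X - z%:P).
  rewrite -[X in _ * X]prodr_undup_exp_count -big_split /=.
  apply: eq_bigr => z _; rewrite -exprD subnK ?XN //.
  exact: leq_trans (count_size _ _) sz_rs.
rewrite polyactM //.
suff -> : polyact D (\prod_(z <- rs) ('X - z%:P)) y = 0.
  by rewrite -[X in polyact _ _ X](polyact0 D y) -polyactM // mulr0 polyact0.
apply/eqP; have := qy; rewrite qE polyactZ => /eqP.
by rewrite scaler_eq0 lead_coef_eq0 (negPf q0).
Qed.

(** Induction on the eigenvalues: [E y - m *: y] splits into eigenvectors for the others, on which
    [E - m] is invertible. [M] records that all components stay in an invariant subspace containing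
    [y]. *)
Lemma semisimple_eigenvectors (F : fieldType) (L : vectType F) (E : L -> L)
    (M : {vspace L}) (rs : seq F) (y : L) :
  (forall x y, E (x + y) = E x + E y) ->
  (forall a x, E (a *: x) = a *: E x) ->
  (forall z, z \in M -> E z \in M) ->
  y \in M -> uniq rs -> foldl (fun w z => E w - z *: w) y rs = 0 ->
  exists f : F -> L, y = \sum_(z <- rs) f z /\
    forall z, z \in rs -> f z \in M /\ E (f z) = z *: f z.
Proof.
move=> ED EZ EM; elim: rs y => [|m rs IH] y yM /=.
  by move=> _ ->; exists (fun=> 0); rewrite big_nil.
case/andP=> m_rs u_rs f0.
have zM : E y - m *: y \in M by rewrite memvB ?EM ?memvZ.
have [f [zE fP]] := IH _ zM u_rs f0.
have E0 : E 0 = 0 by apply: (@addIr _ (E 0)); rewrite -ED !add0r.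
(* This preimage of [E y - m *: y] under [E - m] makes [y - y0] an eigenvector for [m]. *)
pose y0 := \sum_(z <- rs) (z - m)^-1 *: f z.
have y0M : y0 \in M.
  rewrite /y0 big_seq; apply: rpred_sum => z /fP[fM _].
  by rewrite memvZ.
have Ey0 : E y0 - m *: y0 = E y - m *: y.
  rewrite zE /y0 (big_morph E ED E0) scaler_sumr -sumrB.
  apply: eq_big_seq => z zrs; have [_ fz] := fP _ zrs.
  rewrite EZ fz !scalerA -scalerBl [m * _]mulrC -mulrBr mulVf ?scale1r //.
  by rewrite subr_eq0; apply: contraNneq m_rs => <-.
exists (fun z => if z == m then y - y0 else (z - m)^-1 *: f z); split.
  rewrite big_cons eqxx (eq_big_seq (fun z => (z - m)^-1 *: f z)) ?subrK //.
  by move=> z zrs; case: eqP => // zm; rewrite -zm zrs in m_rs.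
move=> z; rewrite inE => /predU1P[->|zrs].
  rewrite eqxx memvB //; split=> //.
  have -> : E (y - y0) = E y - E y0 by rewrite ED -scaleN1r EZ scaleN1r.
  have -> : E y = E y0 - m *: y0 + m *: y by rewrite Ey0 subrK.
  by rewrite scalerBr addrAC [E y0 - _]addrC addrK addrC.
have -> : (z == m) = false by apply/eqP => zm; rewrite -zm zrs in m_rs.
by have [fM fz] := fP _ zrs; rewrite memvZ // EZ fz !scalerA mulrC.
Qed.

(** * Polynomial curves and the p-map *)

Section PolynomialMaps.
Variables (F : fieldType) (L : vectType F).
Implicit Types (f g : F -> L) (s : seq L).

(** A polynomial curve in [L] in Horner form: the entry of [s] at index [i] is the coefficient of
    [c ^+ i], the constant term coming first. *)
Definition vhorner s (c : F) : L := foldr (fun v w => v + c *: w) 0 s.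

Definition polymap f := exists s, f =1 vhorner s.

Lemma eq_polymap f g : f =1 g -> polymap f -> polymap g.
Proof. by move=> fg [s fs]; exists s => c; rewrite -fg. Qed.

Lemma polymap_vhorner s : polymap (vhorner s).
Proof. by exists s. Qed.

Lemma polymap0 : polymap (fun=> 0).
Proof. by exists [::]. Qed.

Lemma polymap_const v : polymap (fun=> v).
Proof. by exists [:: v] => c /=; rewrite scaler0 addr0. Qed.

Lemma polymap_mulX f : polymap f -> polymap (fun c => c *: f c).
Proof. by move=> [s fs]; exists (0 :: s) => c /=; rewrite add0r fs. Qed.

Lemma polymap_mulXn n f : polymap f -> polymap (fun c => c ^+ n *: f c).
Proof.
move=> pf; elim: n => [|n IHn].
  by apply: eq_polymap pf => c; rewrite scale1r.
by apply: eq_polymap (polymap_mulX IHn) => c; rewrite scalerA exprS.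
Qed.

Lemma polymapD f g : polymap f -> polymap g -> polymap (fun c => f c + g c).
Proof.
move=> [s fs] [t gt].
suff [r rE] : polymap (fun c => vhorner s c + vhorner t c).
  by exists r => c; rewrite fs gt rE.
elim: s t {f g fs gt} => [|v s IH] [|w t].
- by exists [::] => c; rewrite addr0.
- by exists (w :: t) => c; rewrite add0r.
- by exists (v :: s) => c; rewrite addr0.
have [r rE] := IH t; exists (v + w :: r) => c /=.
by rewrite -rE scalerDr addrACA.
Qed.

Lemma polymap_sum I (r : seq I) (P : pred I) (f : I -> F -> L) :
  (forall i, polymap (f i)) -> polymap (fun c => \sum_(i <- r | P i) f i c).
Proof.
move=> pf; elim: r => [|i r IH].
  by apply: eq_polymap polymap0 => c; rewrite big_nil.
case Pi: (P i); last by apply: eq_polymap IH => c; rewrite big_cons Pi.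
by apply: eq_polymap (polymapD (pf i) IH) => c; rewrite big_cons Pi.
Qed.

Lemma polymap_linear (h : L -> L) f :
  (forall x y, h (x + y) = h x + h y) ->
  (forall a x, h (a *: x) = a *: h x) ->
  polymap f -> polymap (fun c => h (f c)).
Proof.
move=> hD hZ [s fs]; exists (map h s) => c; rewrite fs.
elim: s {f fs} => /= [|v s IH]; last by rewrite hD hZ IH.
by apply: (@addIr _ (h 0)); rewrite -hD !add0r.
Qed.

End PolynomialMaps.

(** Modulo [W], every coordinate of the curve is a scalar polynomial vanishing on all of [F], hence
    zero, since over an algebraically closed field a nonzero polynomial has a non-root. *)
Lemma vhorner_coef_mem (F : closedFieldType) (L : vectType F)
    (W : {vspace L}) (s : seq L) :
  (forall c, vhorner s c \in W) -> forall i, s`_i \in W.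
Proof.
(* [pr] vanishes exactly on [W] and stands in for the quotient map. *)
move=> sW i; pose pr v := v - projv W v.
have prZD c v w : pr (v + c *: w) = pr v + c *: pr w.
  by rewrite /pr linearD linearZ /= opprD addrACA scalerBr.
have pr0 : pr 0 = 0 by rewrite /pr linear0 subrr.
suff : pr s`_i = 0.
  by move/eqP; rewrite subr_eq0 => /eqP ->; apply: memv_proj.
rewrite (coord_vbasis (memvf (pr s`_i))) big1 // => j _.
set co := coord _ j.
have co0 : co 0 = 0 by rewrite /co linear0.
have coZD c v w : co (v + c *: w) = co v + c * co w.
  by rewrite /co linearD linearZ.
suff -> : co (pr s`_i) = 0 by rewrite scale0r.
pose q := Poly [seq co (pr v) | v <- s].
have q0 : q = 0.
  apply/eqP; apply: contraT => /closed_nonrootP[c] /negP[].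
  rewrite rootE /q horner_Poly; apply/eqP.
  have -> : horner_rec [seq co (pr v) | v <- s] c = co (pr (vhorner s c)).
    elim: (s) => /= [|v t ->]; first by rewrite pr0 co0.
    by rewrite prZD coZD mulrC addrC.
  by rewrite /pr (projv_id (sW c)) subrr co0.
have := coef_Poly [seq co (pr v) | v <- s] i.
rewrite -/q q0 coef0.
have [lt_i|le_i] := ltnP i (size s); first by rewrite (nth_map 0).
by rewrite [s`_i]nth_default // pr0 co0.
Qed.

(** * Jacobson's formula and expansion of the p-map along curves *)

Section JacobsonFormula.
Variables (F : fieldType) (L : vectType F) (br : L -> L -> L).
Hypothesis hLie : is_lie br.
Implicit Types (x y a b : L) (f g : F -> L).

Lemma polymap_br f g :
  polymap f -> polymap g -> polymap (fun c => br (f c) (g c)).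
Proof.
move=> [s fs] pg; elim: s f fs => [|v s IH] f fs.
  by apply: (eq_polymap _ (polymap0 L)) => c; rewrite fs br0l.
have pv : polymap (fun c => br v (g c)).
  apply: (polymap_linear _ _ pg) => *; [exact: brDr|exact: brZr].
apply: (eq_polymap _ (polymapD pv (polymap_mulX (IH _ (frefl _))))) => c.
by rewrite fs /= brDl // brZl.
Qed.

Lemma polymap_jac_s p i f g :
  polymap f -> polymap g -> polymap (fun c => jac_s br p i (f c) (g c)).
Proof.
move=> pf pg; rewrite /jac_s.
apply: polymap_linear => [? ?|? ?|]; first by rewrite scalerDr.
  by rewrite !scalerA mulrC.
apply: polymap_sum => w; rewrite /adword.
elim: (enum _) => //= j s; apply: polymap_br.
by case: (w j).
Qed.

(** Every word in [jac_s] has [i] occurrences of [x]: [i.-1] among its letters, and the innermost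
    vector. *)
Lemma jac_sZ p i c x y : (0 < i)%N ->
  jac_s br p i (c *: x) y = c ^+ i *: jac_s br p i x y.
Proof.
move=> i0; rewrite /jac_s scalerA mulrC -scalerA [c ^+ i *: _]scaler_sumr.
congr (_ *: _).
apply: eq_bigr => w /eqP wi; rewrite -(prednK i0) -wi /adword.
have -> : #|[set j | w j]| = count w (enum 'I_p.-1).
  by rewrite cardsE -sum1_card -sum1_count big_enum_cond; apply: eq_bigl.
elim: (enum _) => /= [|j s IH]; first by rewrite expr1.
rewrite IH; case: (w j) => /=; last by rewrite add0n brZr.
by rewrite brZl // brZr // scalerA -exprS.
Qed.

Lemma jac_s1 p x y : jac_s br p 1 x y = iter p.-1 (br y) x.
Proof.
rewrite /jac_s invr1 scale1r /=.
rewrite (big_pred1 [ffun=> false]) => [|w /=].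
  rewrite /adword -[in RHS](size_enum_ord p.-1).
  by elim: (enum _) => //= j s ->; rewrite ffunE.
rewrite cards_eq0; apply/eqP/eqP => [w0|->].
  apply/ffunP => j; rewrite ffunE; apply/negbTE.
  by have := in_set0 j; rewrite -w0 inE => ->.
by apply/setP => j; rewrite !inE ffunE.
Qed.

Variables (p : nat) (pm : L -> L).
Hypotheses (p_gt1 : (1 < p)%N) (hres : is_restricted br p pm).

Lemma pm_add_scale c x y :
  pm (c *: x + y) =
    c ^+ p *: pm x + pm y + \sum_(1 <= i < p) c ^+ i *: jac_s br p i x y.
Proof.
have [pmZ _ pmD] := hres; rewrite pmD pmZ; congr (_ + _).
by apply: eq_big_nat => i /andP[i0 _]; rewrite jac_sZ.
Qed.

(** Horner form peels off one coefficient at a time, and Jacobson's formula expands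
    [pm (c *: k + v)] into polynomial terms. *)
Lemma polymap_pm f : polymap f -> polymap (fun c => pm (f c)).
Proof.
move=> [s fs]; apply: (eq_polymap (fun c => esym (congr1 pm (fs c)))).
elim: s {f fs} => /= [|v s IH]; first exact: polymap_const.
apply: (@eq_polymap _ _ (fun c => c ^+ p *: pm (vhorner s c) + pm v +
    \sum_(1 <= i < p) c ^+ i *: jac_s br p i (vhorner s c) v)) => [c|].
  by rewrite [v + _]addrC pm_add_scale.
apply: polymapD; first apply: polymapD.
- exact: polymap_mulXn.
- exact: polymap_const.
apply: polymap_sum => i; apply: polymap_mulXn.
by apply: polymap_jac_s; [apply: polymap_vhorner|apply: polymap_const].
Qed.

(* First-order Taylor expansion in [c] of the p-map along a polynomial curve:
   among Jacobson's terms only [s_1], that is [(ad a)^(p-1)], is linear. *)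
Lemma pm_jet a b f : polymap f ->
  exists2 g, polymap g & forall c,
    pm (a + c *: b + c ^+ 2 *: f c) =
      pm a + c *: iter p.-1 (br a) b + c ^+ 2 *: g c.
Proof.
move=> pf; pose k c := b + c *: f c.
have pk : polymap k.
  by apply: polymapD; [apply: polymap_const|apply: polymap_mulX].
(* These are the terms divisible by [c ^+ 2]: the p-th power term, where [1 < p] is used, the
   second-order part of the [s_1] term, and all [s_i] with [i >= 2]. *)
exists (fun c => c ^+ (p - 2) *: pm (k c) + iter p.-1 (br a) (f c) +
    \sum_(2 <= i < p) c ^+ (i - 2) *: jac_s br p i (k c) a).
  apply: polymapD; first apply: polymapD.
  - by apply: polymap_mulXn; apply: polymap_pm.
  - by apply: polymap_linear pf => *; rewrite ?iter_brDr ?iter_brZr.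
  apply: polymap_sum => i; apply: polymap_mulXn.
  by apply: polymap_jac_s => //; apply: polymap_const.
move=> c; have -> : a + c *: b + c ^+ 2 *: f c = c *: k c + a.
  by rewrite /k scalerDr scalerA -expr2 -addrA addrC.
rewrite pm_add_scale big_ltn // jac_s1 expr1 /k iter_brDr // iter_brZr //.
rewrite -/(k c) !scalerDr !scalerA -expr2 -exprD subnKC // scaler_sumr.
have -> : \sum_(2 <= i < p) c ^+ i *: jac_s br p i (k c) a =
    \sum_(2 <= i < p) c ^+ 2 *: (c ^+ (i - 2) *: jac_s br p i (k c) a).
  by apply: eq_big_nat => i /andP[i2 _]; rewrite scalerA -exprD subnKC.
rewrite [X in X + _ = _]addrC -!addrA; congr (_ + _).
by rewrite [LHS]addrCA.
Qed.

Lemma iter_pm_br e x y : br (iter e pm x) y = iter (p ^ e) (br x) y.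
Proof.
have [_ pmE _] := hres; elim: e y => //= e IHe y.
rewrite pmE expnSr; set N := (p ^ e)%N in IHe *.
elim: (p) => [|n IHn]; first by rewrite muln0.
by rewrite iterS IHn IHe mulnS iterD.
Qed.

Lemma iter_pm_jet e x y :
  exists2 g, polymap g & forall c,
    iter e pm (x + c *: y) =
      iter e pm x + c *: iter (p ^ e).-1 (br x) y + c ^+ 2 *: g c.
Proof.
elim: e => [|e [f pf fE]].
  by exists (fun=> 0); [apply: polymap0|move=> c; rewrite scaler0 addr0].
have [g pg gE] := pm_jet (iter e pm x) (iter (p ^ e).-1 (br x) y) pf.
exists g => // c; rewrite !iterS fE gE.
suff -> : iter p.-1 (br (iter e pm x)) (iter (p ^ e).-1 (br x) y) =
    iter (p ^ e.+1).-1 (br x) y by [].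
(* The outer p-map contributes [p.-1] factors, each equal to [p ^ e] copies of [ad x]. *)
have -> : (p ^ e.+1).-1 = ((p ^ e) * p.-1 + (p ^ e).-1)%N.
  have p0 := ltnW p_gt1; have pe0 : (0 < p ^ e)%N by rewrite expn_gt0 p0.
  by rewrite expnSr -!subn1 mulnBr muln1 addnBA // subnK // leq_pmulr.
elim: p.-1 => [|n IHn]; first by rewrite muln0.
by rewrite iterS IHn iter_pm_br -iterD mulnS addnA.
Qed.

End JacobsonFormula.

(** * Engel's theorem *)

Section Engel.
Variables (F : fieldType) (L : vectType F) (br : L -> L -> L).
Hypothesis hLie : is_lie br.
Implicit Types (K H V W : {vspace L}) (h k v x y : L).

(** The adjoint action of [(ad h)^m k] is a signed sum of products [(ad h)^i (ad k) (ad h)^j] with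
    [i + j = m]; the Jacobi identity splits off one [h] at a time. *)
Lemma iter_br_bracket_mem W m h k v :
  (forall i j, (i + j = m)%N -> iter i (br h) (br k (iter j (br h) v)) \in W) ->
  br (iter m (br h) k) v \in W.
Proof.
elim: m k => [|m IHm] k hk; first exact: (hk 0%N 0%N).
rewrite iterSr; apply: IHm => i j ij.
have -> : br (br h k) (iter j (br h) v) =
    br h (br k (iter j (br h) v)) - br k (iter j.+1 (br h) v).
  by rewrite br_jacobi //= addrK.
rewrite -scaleN1r iter_brDr // iter_brZr // scaleN1r memvB //.
  by rewrite -iterSr hk // addSn ij.
by rewrite hk // addnS ij.
Qed.

Lemma iter_mem (f : L -> L) W n x :
  (forall w, w \in W -> f w \in W) -> x \in W -> iter n f x \in W.
Proof. by move=> fW xW; elim: n => //= n; apply: fW. Qed.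

Lemma last_iter_notin (f : L -> L) W n x :
  x \notin W -> iter n f x \in W ->
  exists2 m, iter m f x \notin W & iter m.+1 f x \in W.
Proof.
move=> xW; elim: n => [|n IHn] /= fx; first by rewrite fx in xW.
by case: (boolP (iter n f x \in W)) => [/IHn //|nx]; exists n.
Qed.

(* Engel's theorem for the action of [K] on [V / W].  The subalgebra on which a
   common killed vector is available is enlarged one dimension at a time,
   starting from the kernel of the action, which must be included because only
   modulo that kernel is [K] ad-nilpotent. *)
Lemma engel K V W : subalg br K ->
  (forall k v, k \in K -> v \in V -> br k v \in V) ->
  (forall k w, k \in K -> w \in W -> br k w \in W) ->
  (forall k, k \in K ->
    exists n, forall v, v \in V -> iter n (br k) v \in W) ->
  ~~ (V <= W)%VS ->
  exists v, [/\ v \in V, v \notin W & forall k, k \in K -> br k v \in W].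
Proof.
have [d] := ubnP (\dim K); elim: d K V W => // d IHd K V W /ltnSE le_d.
move=> hK KV KW nilK /subvPn[v0 v0V v0W].
have [K0 K0P] : exists K0 : {vspace L}, forall k, k \in K0 <->
    (k \in K /\ forall v, v \in V -> br k v \in W).
  apply: vspace_of_pred => [|a x y [xK xW] [yK yW]].
    by split=> [|v _]; rewrite ?mem0v // br0l // mem0v.
  split=> [|v vV]; first by rewrite memvD ?memvZ.
  by rewrite brDl // brZl // memvD ?memvZ ?xW ?yW.
suff step n H : (\dim K - \dim H <= n)%N -> subalg br H -> (K0 <= H)%VS ->
    (H <= K)%VS ->
    (exists v, [/\ v \in V, v \notin W & forall k, k \in H -> br k v \in W]) ->
    exists v, [/\ v \in V, v \notin W & forall k, k \in K -> br k v \in W].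
  apply: (step _ K0 (leqnn _)) => //.
  - move=> x y /K0P[xK xV] /K0P[yK yV]; apply/K0P; split; first exact: hK.
    move=> v vV; have -> : br (br x y) v = br x (br y v) - br y (br x v).
      by rewrite (br_jacobi _ x) // addrK.
    by rewrite memvB // KW ?xV ?yV.
  - by apply/subvP => k /K0P[].
  by exists v0; split=> // k /K0P[_ ->].
elim: n H => [|n IHn] H dH hH K0H HK [v [vV vW Hv]].
  have HKE : H = K by apply/eqP; rewrite eqEdim HK -subn_eq0 -leqn0.
  by exists v; split=> //; rewrite -HKE.
case: (boolP (K <= H)%VS) => [KH|KH].
  by exists v; split=> // k /(subvP KH)/Hv.
have ltHK : (\dim H < \dim K)%N.
  by rewrite ltnNge -(geq_leqif (dimv_leqif_sup HK)) in KH *.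
have HinK h : h \in H -> h \in K by apply: subvP.
(* The induction hypothesis for the smaller algebra [H] acting on [K / H] gives a [y] normalizing
   [H]. *)
have [y [yK yH Hy]] : exists y, [/\ y \in K, y \notin H &
    forall h, h \in H -> br h y \in H].
  apply: IHd => //; first exact: leq_trans ltHK le_d.
    by move=> h k hHh kK; apply: hK => //; apply: HinK.
  move=> h /HinK hKh; have [m mW] := nilK _ hKh.
  (* If [i + j = m + m], then [i] or [j] is at least [m], so each term of the expansion falls into
     [W]. *)
  exists (m + m)%N => k kK; apply: (subvP K0H); apply/K0P; split.
    by apply: iter_mem kK => w; apply: hK.
  move=> w wV; apply: iter_br_bracket_mem => i j ij.
  have jV : iter j (br h) w \in V by apply: iter_mem wV => ?; apply: KV.
  have [le_j|lt_j] := leqP m j.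
    apply: iter_mem => [? ?|]; first exact: KW.
    apply: (KW) => //; rewrite -(subnK le_j) iterD.
    by apply: iter_mem (mW _ wV) => ?; apply: KW.
  have le_i : (m <= i)%N.
    by rewrite -(leq_add2r m) -ij leq_add2l ltnW.
  rewrite -(subnK le_i) iterD; apply: iter_mem => [? ?|]; first exact: KW.
  by apply: mW; apply: KV.
have [m mW] := nilK _ yK.
(* The last iterate of [v] under [ad y] outside [W] is killed by [y] modulo [W]; it is still killed
   by [H] because [y] normalizes [H]. *)
have [j nj jW] := last_iter_notin vW (mW _ vV).
apply: (IHn (H + <[y]>)%VS).
- have := dim_add_line yH => lt.
  rewrite -ltnS; apply: leq_trans dH; exact: ltn_sub2l.
- by apply: subalg_add_line => // h hHh; apply: (subvP (addvSl _ _)); apply: Hy.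
- exact: subv_trans K0H (addvSl _ _).
- exact: add_line_sub.
exists (iter j (br y) v); split=> //.
  by apply: iter_mem vV => ?; apply: KV.
move=> _ /memv_addP[h hHh [_ /vlineP[a ->] ->]].
rewrite brDl // brZl // memvD ?memvZ //.
elim: (j) h hHh {nj jW} => [|i IHi] h hHh; first exact: Hv.
rewrite iterS br_jacobi // memvD //; first by apply: IHi; apply: Hy.
by apply: (KW) => //; apply: IHi.
Qed.

End Engel.

(** * Semi-modular subalgebras *)

Section SemiModular.
Variables (F : closedFieldType) (L : vectType F) (br : L -> L -> L).
Hypothesis hLie : is_lie br.
Variable U : {vspace L}.
Hypotheses (hU : subalg br U) (smU : semi_modular br U).
Implicit Types (x y z u s : L).

(** For a subalgebra [U] this says that [U + <[x]>] is a subalgebra, as [[x, x] = 0]. *)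
Definition quasi_normal x := forall u, u \in U -> br u x \in (U + <[x]>)%VS.

Lemma quasi_normal_subalg x : quasi_normal x -> subalg br (U + <[x]>)%VS.
Proof. exact: subalg_add_line. Qed.

(** The line [<[x]>] meets [U] in 0 and covers 0, so upper modularity applies. *)
Lemma covers_gen_line x : x \notin U -> covers br (gen br U <[x]>) U.
Proof.
move=> xU; have [um _] := smU; apply: um; first exact: subalg_line.
have -> : (U :&: <[x]>)%VS = 0%VS.
  apply/eqP; rewrite -subv0; apply/subvP => z; rewrite memv_cap memv0.
  case/andP=> zU /vlineP[a zE]; rewrite zE scaler_eq0 in zU *.
  apply: contraR xU; rewrite negb_or => /andP[a0 _].
  by rewrite -[x](scalerK a0) memvZ.
split; [|exact: subalg_line|exact: sub0v| |].
- by move=> y z; rewrite !memv0 => /eqP-> _; rewrite br0l.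
- by apply: contraNneq xU => x0; rewrite memvE -x0 sub0v.
move=> C _ _ Cx; have [Cx'|nCx] := boolP (x \in C); [right|left].
  by apply/eqP; rewrite eqEsubv Cx -memvE.
apply/eqP; rewrite -subv0; apply/subvP => z zC; rewrite memv0.
have /vlineP[a zE] := subvP Cx _ zC; rewrite zE scaler_eq0 in zC *.
apply: contraR nCx; rewrite negb_or => /andP[a0 _].
by rewrite -[x](scalerK a0) memvZ.
Qed.

Lemma gen_line_id x : x \in gen br U <[x]>.
Proof. by rewrite memvE gen_ger. Qed.

(* As [U] is maximal in [<U, x>], that algebra is also [<U, z>] for each of its
   elements [z] outside [U]. *)
Lemma gen_line_exchange x z :
  x \notin U -> z \in gen br U <[x]> -> z \notin U -> quasi_normal z ->
  x \in (U + <[z]>)%VS.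
Proof.
move=> xU zM zU qz; have [_ _ _ _ max] := covers_gen_line xU.
have [] := max _ (quasi_normal_subalg qz) (addvSl _ _).
- by rewrite add_line_sub // gen_gel.
- by move=> E; case/negP: zU; rewrite -E mem_add_line_self.
- by move=> ->; apply: gen_line_id.
Qed.

Lemma quasi_normal_in x : x \in U -> quasi_normal x.
Proof. by move=> xU u uU; apply: (subvP (addvSl _ _)); apply: hU. Qed.

Lemma quasi_normal_mem x z :
  quasi_normal x -> z \in (U + <[x]>)%VS -> quasi_normal z.
Proof.
move=> qx zx; have [/quasi_normal_in //|zU] := boolP (z \in U).
move=> u uU; have xz := add_line_exchange zx zU.
apply: (subvP (add_line_sub (addvSl _ _) xz)).
by apply: quasi_normal_subalg => //; apply: (subvP (addvSl _ _)).
Qed.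

(* [U] acts on [x] and [y] modulo [U] by the same character: otherwise [<U, x+y>]
   would contain [U + <x>] strictly between [U] and itself. *)
Lemma quasi_normalD x y :
  quasi_normal x -> quasi_normal y -> quasi_normal (x + y).
Proof.
move=> qx qy.
have [yx|yx] := boolP (y \in (U + <[x]>)%VS).
  by apply: quasi_normal_mem qx _; rewrite memvD // mem_add_line_self.
have [xU|xU] := boolP (x \in U).
  apply: quasi_normal_mem qy _; rewrite memvD ?mem_add_line_self //.
  exact: subvP (addvSl _ _) _ xU.
have xyU : x + y \notin U.
  apply: contra yx => xyU; rewrite -[y](addKr x) memvD //.
    by rewrite memvN mem_add_line_self.
  exact: subvP (addvSl _ _) _ xyU.
move=> u uU; apply: contraT => nxy; case/negP: yx.
(* Modulo [U], [[u, x]] is [a *: x] and [[u, y]] is [b *: y], with [a != b] by [nxy]; subtracting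
   [b *: (x + y)] from [[u, x + y]] isolates [x]. *)
have xM : x \in gen br U <[x + y]>.
  have /mem_add_line[a ux] := qx u uU; have /mem_add_line[b uy] := qy u uU.
  have E : br u (x + y) = (br u x - a *: x) + (br u y - b *: y) +
      ((a - b) *: x + b *: (x + y)).
    rewrite brDr // scalerBl scalerDr (addrA (a *: x - _)) subrK addrACA.
    by rewrite !subrK.
  have ab : a - b != 0.
    apply: contraNneq nxy => ab0; rewrite E ab0 scale0r add0r.
    by apply/mem_add_line; exists b; rewrite addrK memvD.
  have xE : x = (a - b)^-1 *: (br u (x + y) -
      ((br u x - a *: x) + (br u y - b *: y)) - b *: (x + y)).
    rewrite E; set P := br u x - _ + _.
    by rewrite (addrC P) !addrK scalerA mulVf // scale1r.
  have UM := subvP (gen_gel br U <[x + y]>).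
  rewrite [X in X \in _]xE; apply: memvZ; apply: memvB; first apply: memvB.
  - by apply: subalg_gen; [|apply: UM|apply: gen_line_id].
  - by apply: UM; apply: memvD.
  - by apply: memvZ; apply: gen_line_id.
have xyx := gen_line_exchange xyU xM xU qx.
by rewrite -[y](addKr x) memvD // memvN mem_add_line_self.
Qed.

Lemma quasi_normal_vspace :
  exists Q : {vspace L}, forall x, x \in Q <-> quasi_normal x.
Proof.
apply: vspace_of_pred => [|a x y qx qy].
  by apply: quasi_normal_in; apply: mem0v.
apply: quasi_normalD => //; apply: quasi_normal_mem qx _.
by rewrite memvZ // mem_add_line_self.
Qed.

(** Otherwise [B = <s, y>] would cover [U :&: B] by lower modularity. But [U :&: B] lies in [<[s]>],
    and [<[s]>] would be strictly between [U :&: B] and [B]. *)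
Lemma eigenvector_mem s y m : s \notin U -> y \in gen br U <[s]> ->
  br s y = m *: y -> y \in (U + <[s]>)%VS.
Proof.
move=> sU yM sy; apply: contraT => yUs; pose B := (<[s]> + <[y]>)%VS.
have hB : subalg br B.
  apply: subalg_add_line => //; first exact: subalg_line.
  move=> _ /vlineP[a ->]; rewrite brZl // sy !memvZ //.
  exact: mem_add_line_self.
have [_ lm] := smU; have [] := covers_gen_line sU.
set M := gen br U <[s]> in yM * => _ _ UM UneM maxM.
have sB : s \in B by apply: subvP (addvSl _ _) _ (memv_line s).
have BM : (B <= M)%VS by rewrite add_line_sub // gen_ger.
have genB : gen br U B = M.
  apply: gen_eq; [exact: subalg_gen|by rewrite subv_add UM|].
  apply: gen_sub; [exact: subalg_gen|exact: gen_gel|].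
  by apply: subv_trans (gen_ger _ _ _); rewrite -memvE.
have [|_ _ _ _ maxB] := lm B hB.
  by rewrite genB; split=> //; apply: subalg_gen.
have [] := maxB <[s]>%VS (subalg_line hLie (x:=s)) _ (addvSl _ _).
- apply/subvP => z; rewrite memv_cap => /andP[zU /mem_add_line[b]].
  have [->|b0] := eqVneq b 0; first by rewrite scale0r subr0.
  move=> /vlineP[a zE]; case/negP: yUs; apply/mem_add_line.
  exists (- b^-1 * a); rewrite mulNr scaleNr opprK.
  have -> : y + (b^-1 * a) *: s = b^-1 *: z.
    by rewrite -[z](subrK (b *: y)) zE scalerDr !scalerA mulVf // scale1r addrC.
  exact: memvZ.
- move=> E; have := memv_line s; rewrite E memv_cap => /andP[sU' _].
  by rewrite sU' in sU.
- move=> E; case/negP: yUs; apply: (subvP (addvSr _ _)).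
  by rewrite E mem_add_line_self.
Qed.

(** * The p-map and the quasi-ideal property *)

Variables (p : nat) (pm : L -> L).
Hypotheses (charFp : p \in [pchar F]) (hres : is_restricted br p pm).

Lemma iter_pm_quasi_normal e x :
  (\dim {:L} <= p ^ e)%N -> quasi_normal (iter e pm x).
Proof.
move=> le_e; set s := iter e pm x.
have [/quasi_normal_in //|sU] := boolP (s \in U).
pose M := gen br U <[s]>; have hM : subalg br M by exact: subalg_gen.
have sE y : iter (p ^ e) (br x) y = br s y by rewrite (iter_pm_br hres).
(* [ad s = (ad x)^(p^e)] is diagonalizable, so [M] is spanned by eigenvectors of [s], each of them
   in [U + <[s]>]. *)
suff MU : (M <= U + <[s]>)%VS.
  move=> u uU; apply: (subvP MU); apply: hM; last exact: gen_line_id.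
  exact: subvP (gen_gel _ _ _) _ uU.
apply/subvP => y yM.
have [rs u_rs f0] := iter_pchar_semisimple y
  (fun a b => brDr hLie a b x) (fun a b => brZr hLie a b x) charFp le_e.
have {}f0 : foldl (fun w (z : F) => br s w - z *: w) y rs = 0.
  by rewrite -f0; elim: (rs) (y) => //= z r IH w; rewrite sE IH.
have sM z : z \in M -> br s z \in M by apply: hM; apply: gen_line_id.
have [f [-> fP]] := semisimple_eigenvectors
  (fun a b => brDr hLie a b s) (fun a b => brZr hLie a b s) sM yM u_rs f0.
rewrite big_seq; apply: rpred_sum => z /fP[fM fz].
exact: eigenvector_mem fM fz.
Qed.

Lemma semi_modular_quasi_ideal : quasi_ideal br U.
Proof.
have p_gt1 : (1 < p)%N := prime_gt1 (pcharf_prime charFp).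
have [Q QP] := quasi_normal_vspace.
have UQ u : u \in U -> u \in Q by move=> uU; apply/QP/quasi_normal_in.
suff Qfull : (fullv <= Q)%VS.
  move=> V u v uU vV; have /QP/(_ u uU) := subvP Qfull v (memvf v).
  by apply: subvP; rewrite add_line_sub ?addvSl // (subvP (addvSr _ _)).
pose e := \dim {:L}.
have le_e : (e <= p ^ e)%N by apply: ltnW; apply: ltn_expl.
apply: contraT => nQ.
have [|||x [_ xQ Ux]] := engel hLie hU (V := fullv) (W := Q) _ _ _ nQ.
- by move=> *; apply: memvf.
- move=> u x uU /QP qx; apply/QP/(quasi_normal_mem qx); exact: qx.
- move=> u uU; exists (p ^ e).-1 => y _.
  have [f [s fs] jet] := iter_pm_jet hLie p_gt1 hres e u y.
  (* The whole curve lies in [Q], so its coefficient of index 1, [(ad u)^(p^e - 1) y], does too. *)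
  have := @vhorner_coef_mem F L Q
    [:: iter e pm u, iter (p ^ e).-1 (br u) y & s] _ 1%N.
  apply=> c /=; rewrite -fs scalerDr scalerA -expr2 addrA -jet.
  by apply/QP; apply: iter_pm_quasi_normal.
have xU : x \notin U by apply: contra xQ => /UQ.
have xQ' := xQ; case/negP: xQ; apply/QP => u uU; apply: (subvP (addvSl _ _)).
(* If [[u, x]], an element of both [Q] and [<U, x>], were outside [U], the exchange would put [x] in
   [U + <[u, x]>], hence in [Q]. *)
have uxQ := Ux u uU; have /QP quxQ := uxQ; apply: contraT => uxU.
have uxM : br u x \in gen br U <[x]>.
  apply: subalg_gen => //; last exact: gen_line_id.
  exact: subvP (gen_gel _ _ _) _ uU.
have xux := gen_line_exchange xU uxM uxU quxQ.
by case/negP: xQ'; apply/QP; apply: quasi_normal_mem quxQ xux.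
Qed.

End SemiModular.

Theorem theorem2p7 (F : closedFieldType) (p : nat) (charFp : p \in [pchar F])
    (L : vectType F) (br : L -> L -> L) (hLie : is_lie br)
    (pm : L -> L) (hres : is_restricted br p pm)
    (U : {vspace L}) (hU : subalg br U) (hproper : U != fullv) :
  [<-> modular br U; semi_modular br U; quasi_ideal br U].
Proof.
split; first exact: modular_semi_modular.
split; last exact: quasi_ideal_modular.
by move=> smU; apply: (semi_modular_quasi_ideal hLie hU smU charFp hres).
Qed.
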